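(* Let $f(x),g(x)\in\mathbb{Z}[x]$ be such that $g(n)\neq 0$ for every $n\in\mathbb{Z}$. Then there exists $L\in\mathbb{N}$ such that for every $n\in\mathbb{Z}$, the number of terms in the expansion of the rational number $h(n)=\frac{f(n)}{g(n)}$ as a finite simple continued fraction is no greater than $L$.
   Context: A finite simple continued fraction $[a_0;a_1,\dots,a_k]$ is the expression $a_0+\cfrac{1}{a_1+\cfrac{1}{\ddots+\cfrac{1}{a_k}}}$ with $a_0\in\mathbb{Z}$ and $a_1,\dots,a_k$ positive integers; its number of terms is $k+1$. Every rational number has such an expansion, unique under the usual convention that $a_k\ge 2$ when $k\ge 1$. *)

(* Defs.v *)
From mathcomp Require Import all_boot all_order all_algebra.
From mathcomp Require Import zify ring lra.

Set Implicit Arguments.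
Unset Strict Implicit.
Unset Printing Implicit Defensive.

Import Order.TTheory GRing.Theory Num.Theory.
Local Open Scope ring_scope.

(* [cf_value a0 [:: a1; ..; ak]] is the value of [a0; a1, ..., ak]. The inverse
   is never taken at 0 when a1, ..., ak are positive. *)
Fixpoint cf_value (a : int) (s : seq int) : rat :=
  if s is b :: t then a%:~R + (cf_value b t)^-1 else a%:~R.

(* The second clause is the usual normalization ak >= 2 for k >= 1, which
   excludes the alternative ending [..., ak - 1, 1]. *)
Definition simple_cf (a0 : int) (s : seq int) : bool :=
  all (fun a => 0 < a) s && ((s != [::]) ==> (2 <= last a0 s)).

Definition is_cf_expansion (q : rat) (e : int * seq int) : bool :=
  simple_cf e.1 e.2 && (cf_value e.1 e.2 == q).

Lemma cf_expansion_ratio (d : nat) (m : int) : (0 < d)%N ->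
  exists s, is_cf_expansion (m%:~R / d%:R) ((m %/ d)%Z, s).
Proof.
elim/ltn_ind: d m => d IH m d_gt0.
have dz : d%:Z != 0 by lia.
have dq : d%:R != 0 :> rat by rewrite pnatr_eq0 -lt0n.
have Em := divz_eq m d; have r_ge0 := modz_ge0 m dz.
have r_lt : (m %% d)%Z < d%:Z by rewrite ltz_pmod //; lia.
set a := (m %/ d)%Z in Em *.
case Er : (m %% d)%Z r_ge0 r_lt Em => [r|//] _ r_lt Em.
have Eq : m%:~R / d%:R = a%:~R + r%:R / d%:R :> rat.
  by rewrite Em rmorphD rmorphM /= -!pmulrn mulrDl mulfK.
case: (posnP r) => [r0|r_gt0].
  exists [::]; rewrite /is_cf_expansion /simple_cf /=.
  by rewrite Eq r0 mul0r addr0.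
have [|s] := IH r _ d r_gt0; first by lia.
have b_gt0 : 0 < (d %/ r)%Z by rewrite divz_nat; move: (divn_gt0 d r_gt0); lia.
rewrite /is_cf_expansion /simple_cf /= => /andP[/andP[s_pos s_last] /eqP Ev].
exists ((d %/ r)%Z :: s) => /=.
rewrite b_gt0 s_pos Ev Eq invf_div eqxx andbT /=.
case: s s_last Ev {s_pos} => [_ /= Ev|//].
have rq : r%:R != 0 :> rat by rewrite pnatr_eq0 -lt0n.
suff : (1 : rat) < ((d %/ r)%Z)%:~R by rewrite ltr1z; lia.
by rewrite Ev -pmulrn ltr_pdivlMr ?ltr0n // mul1r ltr_nat; lia.
Qed.

Lemma cf_expansion_exists (q : rat) : exists e, is_cf_expansion q e.
Proof.
have d_gt0 : (0 < `|denq q|)%N by rewrite absz_gt0 denq_neq0.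
have [s] := cf_expansion_ratio (numq q) d_gt0.
have -> : `|denq q|%:R = (denq q)%:~R :> rat by rewrite pmulrn absz_denq.
by rewrite divq_num_den; exists ((numq q %/ `|denq q|)%Z, s).
Qed.

Lemma simple_cf_tail (a b : int) (t : seq int) :
  simple_cf a (b :: t) -> simple_cf b t.
Proof.
rewrite /simple_cf /= => /andP[/andP[_ ->] h] /=.
by apply/implyP.
Qed.

Lemma cf_value_gt1 (a b : int) (t : seq int) :
  simple_cf a (b :: t) -> 1 < cf_value b t.
Proof.
elim: t a b => [|c t IH] a b H.
  by move: H; rewrite /simple_cf /= ltr1z; lia.
have /= v_gt1 := IH _ _ (simple_cf_tail H).
have b_ge1 : (1 : rat) <= b%:~R.
  by move: H; rewrite /simple_cf /= ler1z; lia.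
have : 0 < (cf_value c t)^-1 by rewrite invr_gt0; lra.
by rewrite /=; lra.
Qed.

Lemma cf_value_floor (a : int) (s : seq int) :
  simple_cf a s -> Num.floor (cf_value a s) = a.
Proof.
move=> H; apply/eqP; rewrite floor_eq.
case: s H => [|b t] H /=; first by rewrite lexx intrD; lra.
have v_gt1 := cf_value_gt1 H.
have : 0 < (cf_value b t)^-1 by rewrite invr_gt0; lra.
have : (cf_value b t)^-1 < 1 by rewrite invf_lt1; lra.
by rewrite intrD; lra.
Qed.

Lemma cf_expansion_unique (q : rat) (e e' : int * seq int) :
  is_cf_expansion q e -> is_cf_expansion q e' -> e = e'.
Proof.
case: e e' => a s [a' s'].
rewrite /is_cf_expansion /= => /andP[H /eqP <-] /andP[H' /eqP].
elim: s a a' s' H H' => [|b t IH] a a' s' H H' E.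
all: have Ea : a = a' by rewrite -(cf_value_floor H) -E cf_value_floor.
all: subst a'; case: s' H' E => [|b' t'] H' //= E.
- have v_gt1 := cf_value_gt1 H'.
  have i_gt0 : 0 < (cf_value b' t')^-1 by rewrite invr_gt0; lra.
  by exfalso; lra.
- have v_gt1 := cf_value_gt1 H.
  have i_gt0 : 0 < (cf_value b t)^-1 by rewrite invr_gt0; lra.
  by exfalso; lra.
- have /invr_inj Ev := addrI _ E.
  by have [-> ->] := IH _ _ _ (simple_cf_tail H) (simple_cf_tail H') Ev.
Qed.

Definition cf_expansion (q : rat) : int * seq int :=
  xchoose (cf_expansion_exists q).

Lemma cf_expansionP (q : rat) : is_cf_expansion q (cf_expansion q).
Proof. exact: xchooseP. Qed.

Lemma cf_expansionE (q : rat) (e : int * seq int) :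
  is_cf_expansion q e -> cf_expansion q = e.
Proof. exact: cf_expansion_unique (cf_expansionP q). Qed.

(* k + 1 for the expansion [a0; a1, ..., ak] *)
Definition cf_num_terms (q : rat) : nat := (size (cf_expansion q).2).+1.

(* Main.v *)
Require Import Defs.
From mathcomp Require Import all_boot all_order all_algebra.
From mathcomp Require Import zify ring lra.

Import Order.TTheory GRing.Theory Num.Theory.
Local Open Scope ring_scope.

(** The number of terms is bounded because [f.[n]] and [g.[n]] can be taken
    through Euclid's algorithm uniformly in [n], following the division of
    polynomials.  Since a polynomial quotient may be negative or too small at
    a given [n], remainders are not required to be reduced: [euclid_within k p
    q] says that some choice of integer quotients brings the pair [(p, q)] to a
    pair [(d, 0)] in at most [k] steps.

    Pseudo-division over the integers gives [c f = u g + r] with a constant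
    [c != 0], so a bound for the pairs [(g.[n], r.[n])] yields one for the pairs
    [(c f.[n], g.[n])], and the factor [c] has to be removed.  Multiplying the
    second entry by [c] gives the pair [c (f.[n], g.[n])], and the relation does
    not see common factors.  It remains to see that multiplying one entry by a
    constant raises the number of steps only by a bounded amount; this is the
    case of diagonal matrices in [euclid_within_linear], which treats all 2 x 2
    integer matrices with bounded entries because those are what the induction
    produces.

    The passage from arbitrary quotients to the continued fraction rests on
    [cf_num_terms_inv]: inverting a rational number of either sign adds at most
    three terms, while adding an integer adds none.  Hence [k] steps of
    division give at most [3 k + 1] terms ([cf_num_terms_euclid]). *)

(** * Number of terms under translation, negation and inversion *)

Lemma cf_num_terms_int (a : int) : cf_num_terms a%:~R = 1%N.
Proof.
rewrite /cf_num_terms (@cf_expansionE _ (a, [::])) //.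
by rewrite /is_cf_expansion /simple_cf /= eqxx.
Qed.

Lemma cf_num_terms_addz (a : int) (x : rat) :
  cf_num_terms (a%:~R + x) = cf_num_terms x.
Proof.
rewrite /cf_num_terms.
have := cf_expansionP x; case: (cf_expansion x) => b s.
rewrite /is_cf_expansion /= => /andP[H /eqP Ex].
rewrite (@cf_expansionE _ (a + b, s)) // /is_cf_expansion /=.
apply/andP; split; first by case: s H {Ex}.
by rewrite -Ex; case: s {H Ex} => [|c t] /=; rewrite intrD ?addrA.
Qed.

Lemma cf_num_terms_inv_gt1 (y : rat) : 1 < y ->
  cf_num_terms y^-1 = (cf_num_terms y).+1.
Proof.
move=> y_gt1; rewrite /cf_num_terms.
have := cf_expansionP y; case: (cf_expansion y) => b s.
rewrite /is_cf_expansion /= => /andP[H /eqP Ey].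
have b_gt0 : 0 < b.
  have := cf_value_floor H; rewrite Ey => <-.
  by rewrite floor_gt0 ltW.
rewrite (@cf_expansionE _ (0, b :: s)) // /is_cf_expansion /= Ey add0r eqxx.
move: H; rewrite /simple_cf /= b_gt0 => /andP[-> H] /=; rewrite andbT.
case: s H Ey => [|//] _ /= Eb.
by move: y_gt1; rewrite -Eb ltr1z; lia.
Qed.

Lemma cf_num_terms_inv_lt1 (x : rat) : 0 < x -> x < 1 ->
  cf_num_terms x = (cf_num_terms x^-1).+1.
Proof.
move=> x_gt0 x_lt1; rewrite -cf_num_terms_inv_gt1 ?invrK //.
by rewrite invf_gt1.
Qed.

(** For [1/2 < x < 1] the expansion [[0; 1, b, ...]] of [x] turns into the
    expansion [[0; b + 1, ...]] of [1 - x]. *)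
Lemma cf_num_terms_onem (x : rat) : 1 / 2 < x -> x < 1 ->
  cf_num_terms x = (cf_num_terms (1 - x)).+1.
Proof.
move=> x_gt x_lt1.
have x0 : x != 0 by lra.
have y0 : 1 - x != 0 by lra.
have w_gt1 : 1 < x / (1 - x) by rewrite ltr_pdivlMr; lra.
have Ex : x^-1 = 1%:~R + (x / (1 - x))^-1 by field; rewrite x0 y0.
have Ey : (1 - x)^-1 = 1%:~R + x / (1 - x) by field.
set w := x / (1 - x) in w_gt1 Ex Ey.
rewrite cf_num_terms_inv_lt1 //; last by lra.
rewrite [cf_num_terms (1 - x)]cf_num_terms_inv_lt1; [|lra|lra].
by rewrite Ex Ey !cf_num_terms_addz cf_num_terms_inv_gt1.
Qed.

(** Up to integers, negation sends the fractional part [y] of [x] to [1 - y];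
    when [0 < y] and [y != 1 / 2], the smaller of [y] and [1 - y] has one term
    less than the other. *)
Lemma cf_num_terms_opp (x : rat) :
  (cf_num_terms (- x) <= (cf_num_terms x).+1)%N.
Proof.
have [z [y [-> y_ge0 y_lt1]]] :
    exists z : int, exists y : rat, [/\ x = z%:~R + y, 0 <= y & y < 1].
  exists (Num.floor x), (x - (Num.floor x)%:~R).
  have := floor_itv x; rewrite intrD => /andP[h1 h2].
  by split; lra.
have -> : - (z%:~R + y) = (- z - 1)%:~R + (1 - y) by rewrite intrD rmorphN /=; ring.
rewrite !cf_num_terms_addz.
have [->|y_neq0] := eqVneq y 0.
  by rewrite subr0 (cf_num_terms_int 1).
have [y_lt|y_gt|->] := ltgtP y (1 / 2).
- rewrite (@cf_num_terms_onem (1 - y)); [|lra|lra].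
  by rewrite subKr.
- by rewrite (@cf_num_terms_onem y) //; lia.
- by have -> : 1 - 1 / 2 = 1 / 2 :> rat by field.
Qed.

Lemma cf_num_terms_inv_pos (x : rat) : 0 < x ->
  (cf_num_terms x^-1 <= (cf_num_terms x).+1)%N.
Proof.
move=> x_gt0; have [x_lt1|x_gt1|->] := ltgtP x 1.
- by rewrite [cf_num_terms x]cf_num_terms_inv_lt1 //; lia.
- by rewrite cf_num_terms_inv_gt1.
- by rewrite invr1.
Qed.

(** A negative number is negated, inverted and negated again, each of these
    operations adding at most one term. *)
Lemma cf_num_terms_inv (x : rat) :
  (cf_num_terms x^-1 <= cf_num_terms x + 3)%N.
Proof.
have [x_lt0|x_gt0|->] := ltgtP x 0.
- have h1 := cf_num_terms_opp x.
  have h2 : (cf_num_terms (- x)^-1 <= (cf_num_terms (- x)).+1)%N.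
    by apply: cf_num_terms_inv_pos; lra.
  have := cf_num_terms_opp (- x)^-1; rewrite invrN opprK; rewrite invrN in h2.
  by lia.
- by have := cf_num_terms_inv_pos x x_gt0; lia.
- by rewrite invr0 leq_addr.
Qed.

(** * Euclid's algorithm with arbitrary integer quotients *)

Fixpoint euclid_within (k : nat) (p q : int) : Prop :=
  q = 0 \/
  if k is k'.+1 then exists a : int, euclid_within k' q (p - a * q) else False.

Lemma euclid_within_stop (k : nat) (p : int) : euclid_within k p 0.
Proof. by case: k => [|k]; left. Qed.

Lemma euclid_within_step (k : nat) (a p q : int) :
  euclid_within k q (p - a * q) -> euclid_within k.+1 p q.
Proof. by move=> H; right; exists a. Qed.

Lemma euclid_within_cancel (c : int) (k : nat) (p q : int) : c != 0 ->
  euclid_within k (c * p) (c * q) -> euclid_within k p q.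
Proof.
move=> c0; elim: k p q => [|k IH] p q [/eqP|].
- by rewrite mulf_eq0 (negPf c0) => /eqP->; left.
- by [].
- by rewrite mulf_eq0 (negPf c0) => /eqP->; left.
- move=> [a H]; right; exists a; apply: IH.
  by rewrite mulrBr (mulrCA c a).
Qed.

Lemma euclid_within_leq (k l : nat) (p q : int) : (k <= l)%N ->
  euclid_within k p q -> euclid_within l p q.
Proof.
elim: k l p q => [|k IH] l p q le_kl.
  by case=> // ->; apply: euclid_within_stop.
case: l le_kl => // l le_kl [->|[a H]]; first exact: euclid_within_stop.
by right; exists a; apply: IH.
Qed.

(** Row operations reduce a bounded matrix to an upper triangular one: each
    step of Euclid's algorithm on the first column of the matrix is also a step
    for the image pair, it makes the lower left entry smaller, and the other
    entries stay bounded in terms of [B]. *)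
Lemma euclid_within_triangularize (P : int -> int -> Prop) :
  (forall B : nat, exists L : nat, forall a1 b1 b2 x y : int,
    (`|a1| <= B)%N -> (`|b1| <= B)%N -> (`|b2| <= B)%N -> P x y ->
    euclid_within L (a1 * x + b1 * y) (b2 * y)) ->
  forall c B : nat, exists L : nat, forall a1 b1 a2 b2 x y : int,
    (`|a1| <= B)%N -> (`|b1| <= B)%N -> (`|a2| <= c)%N -> (`|b2| <= B)%N ->
    P x y -> euclid_within L (a1 * x + b1 * y) (a2 * x + b2 * y).
Proof.
move=> Htri; elim=> [|c IH] B.
  have [L HL] := Htri B; exists L => a1 b1 a2 b2 x y ha1 hb1 ha2 hb2 Pxy.
  have -> : a2 = 0 by lia.
  by rewrite mul0r add0r; apply: HL.
(* the coefficient of [y] in the new remainder is [b1 - m b2], with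
   [|m| <= |a1|] *)
have [L HL] := IH (c.+1 + B + B * B)%N.
exists L.+1 => a1 b1 a2 b2 x y ha1 hb1 ha2 hb2 Pxy.
have [a20|a20] := eqVneq a2 0.
  by apply: (@euclid_within_leq L) => //; apply: HL => //; lia.
have Ea := divz_eq a1 a2; have r_ge0 := modz_ge0 a1 a20.
have r_lt : (a1 %% a2)%Z < `|a2| by rewrite ltz_mod.
have m_le : (`|(a1 %/ a2)%Z| <= B)%N.
  exact: leq_trans (lez_div _ _) ha1.
set m := (a1 %/ a2)%Z in Ea m_le; set r := (a1 %% a2)%Z in Ea r_ge0 r_lt.
apply: (@euclid_within_step _ m).
have -> : a1 * x + b1 * y - m * (a2 * x + b2 * y) = r * x + (b1 - m * b2) * y.
  by rewrite Ea; ring.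
have mb : (`|(m * b2)%R| <= B * B)%N by rewrite abszM leq_mul.
by apply: HL => //; lia.
Qed.

(** For a triangular matrix, write [x = a y + z]: the image pair is
    [((a1 a + b1) y + a1 z, b2 y)].  The quotient [a] is unbounded, but dividing
    [a1 a + b1] by [b2] absorbs it and leaves the image of [(y, z)] under a
    matrix with entries bounded by [B], while [(y, z)] needs one step less. *)
Lemma euclid_within_linear (k c B : nat) : exists L : nat,
  forall a1 b1 a2 b2 x y : int,
    (`|a1| <= B)%N -> (`|b1| <= B)%N -> (`|a2| <= c)%N -> (`|b2| <= B)%N ->
    euclid_within k x y ->
    euclid_within L (a1 * x + b1 * y) (a2 * x + b2 * y).
Proof.
elim: k c B => [|k IH] c B; apply: euclid_within_triangularize => {c B} B.
  exists 0%N => a1 b1 b2 x y _ _ _ [->|//].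
  by rewrite !mulr0; apply: euclid_within_stop.
have [L HL] := IH B B; exists L.+1 => a1 b1 b2 x y ha1 hb1 hb2 [->|[a H]].
  by rewrite !mulr0; apply: euclid_within_stop.
have [->|b20] := eqVneq b2 0.
  by rewrite mul0r; apply: euclid_within_stop.
have Ea := divz_eq (a1 * a + b1) b2.
have r_ge0 := modz_ge0 (a1 * a + b1) b20.
have r_lt : ((a1 * a + b1) %% b2)%Z < `|b2| by rewrite ltz_mod.
set m := ((a1 * a + b1) %/ b2)%Z in Ea.
set r := ((a1 * a + b1) %% b2)%Z in Ea r_ge0 r_lt.
apply: (@euclid_within_step _ m).
have -> : a1 * x + b1 * y - m * (b2 * y) = r * y + a1 * (x - a * y).
  have -> : r = a1 * a + b1 - m * b2 by rewrite Ea; ring.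
  by ring.
have -> : b2 * y = b2 * y + 0 * (x - a * y) by ring.
by apply: HL => //; lia.
Qed.

(** The first step replaces [p / q] by the inverse of [q / (p - a q)] plus an
    integer, so it adds at most three terms; division by [0] yields [0], which
    has a single term. *)
Lemma cf_num_terms_euclid (k : nat) (p q : int) : euclid_within k p q ->
  (cf_num_terms (p%:~R / q%:~R) <= 3 * k + 1)%N.
Proof.
have T0 (x : int) : cf_num_terms (x%:~R / 0%:~R) = 1%N.
  by rewrite invr0 mulr0 (cf_num_terms_int 0).
elim: k p q => [|k IH] p q [->|]; rewrite ?T0 ?leq_addl //.
case=> a /IH H; have [->|q0] := eqVneq q 0; first by rewrite T0 leq_addl.
have q0' : q%:~R != 0 :> rat by rewrite intr_eq0.
have -> : p%:~R / q%:~R = a%:~R + (q%:~R / (p - a * q)%:~R)^-1 :> rat.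
  by rewrite invf_div intrB intrM; field.
by rewrite cf_num_terms_addz; apply: leq_trans (cf_num_terms_inv _) _; lia.
Qed.

(** * Values of two integer polynomials *)

Lemma euclid_within_horner (f g : {poly int}) : exists L : nat,
  forall n : int, euclid_within L f.[n] g.[n].
Proof.
have [s] := ubnP (size g); elim: s f g => // s IH f g; rewrite ltnS => gs.
have [->|g0] := eqVneq g 0.
  by exists 0%N => n; left; rewrite horner0.
have [|L HL] := IH g (f %% g); first by apply: leq_trans gs; rewrite ltn_modp.
have := Pdiv.Idomain.divp_eq f g; set c := lead_coef g ^+ _ => Ef.
have c0 : c != 0 by rewrite expf_neq0 // lead_coef_eq0.
(* the bounds are those for the matrix diag (1, c) *)
have [L' HL'] := euclid_within_linear L.+1 0 `|c|.+1.
exists L' => n; apply: (euclid_within_cancel _ _ _ _ c0).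
have H : euclid_within L.+1 (c * f.[n]) g.[n].
  apply: (@euclid_within_step _ (f %/ g).[n]).
  by rewrite -hornerZ Ef hornerD hornerM addrC addKr.
have := HL' 1 0 0 c _ _ isT isT isT (leqnSn _) H.
by rewrite mul1r !mul0r addr0 add0r.
Qed.

Theorem theorem27 (f g : {poly int}) (hg : forall n : int, g.[n] != 0) :
  exists L : nat, forall n : int,
    (cf_num_terms ((f.[n])%:~R / (g.[n])%:~R) <= L)%N.
Proof.
have [L HL] := euclid_within_horner f g.
by exists (3 * L + 1)%N => n; apply: cf_num_terms_euclid.
Qed.
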